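(* Let $a \geq 3$ be an odd integer and let $d$ be a positive integer with $d \leq D_4(a)$. Then $$N_{1/a}(d) \leq \frac{1}{2}(a^2-1)(a^2-2).$$ Furthermore, as $a$ tends to infinity (through odd integers), $$D_4(a) = 3a^2 + \frac{12}{\sqrt{5}}a - \frac{948}{25} + O(a^{-1}).$$
   Context: A set of lines through the origin in $\mathbb{R}^d$ is equiangular if any two distinct lines in the set form the same angle; it has inner product $\alpha\in[0,1)$ if unit vectors $c,c'$ chosen along any two distinct lines satisfy $c\cdot c'=\pm\alpha$. $N_\alpha(d)$ denotes the maximum cardinality of a set of equiangular lines in $\mathbb{R}^d$ with prescribed inner products $\pm\alpha$. For an odd integer $a\ge 3$, $D_4(a)$ is the maximum (real) root of the equation $g_a(x)=0$, where $$\begin{aligned} g_a(x) ={}& (-7a^{14} - 122a^{12} - 342a^{10} + 2776a^8 + 7049a^6 - 17238a^4 - 22932a^2 - 6048)x^4 \\ &+ 12(4a^{16} + 21a^{14} - 227a^{12} - 46a^{10} + 3338a^8 - 7643a^6 + 2693a^4 + 7140a^2 + 864)x^3 \\ &-9a^2(11a^{16} - 94a^{14} - 25a^{12} + 3068a^{10} - 13951a^8 + 25882a^6 - 15987a^4 - 9608a^2 + 14800)x^2 \\ &+ 54a^2(a-2)^2(a-1)^2(a+1)^2(a+2)^2(a^2+1)(a^4 - a^3 - 5a^2 + 3a + 10)(a^4 + a^3 - 5a^2 - 3a + 10)x \\ &-81a^2(a - 2)^4(a - 1)^4(a + 1)^4(a + 2)^4. \end{aligned}$$ *)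

(* Defs.v *)
From HB Require Import structures.
From mathcomp Require Import all_boot all_order all_algebra.
From mathcomp Require Import ring lra.
From mathcomp Require Import all_classical all_reals all_analysis.
From mathcomp Require polyrcf.

Set Implicit Arguments.
Unset Strict Implicit.
Unset Printing Implicit Defensive.

Import Order.TTheory GRing.Theory Num.Theory.
Import numFieldNormedType.Exports.

Local Open Scope card_scope.
Local Open Scope classical_set_scope.
Local Open Scope ring_scope.

Definition dotv (R : realType) (d : nat) (u v : 'rV[R]_d) : R :=
  \sum_(i < d) u ord0 i * v ord0 i.

(* A line through the origin is a subspace of dimension 1. *)
Definition equiangular (R : realType) (d : nat) (alpha : R)
    (L : set {vspace 'rV[R]_d}) : Prop :=
  (forall l, L l -> \dim l = 1%N) /\
  (forall l l', L l -> L l' -> l <> l' ->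
     forall c c' : 'rV[R]_d, c \in l -> c' \in l' ->
       dotv c c = 1 -> dotv c' c' = 1 ->
       dotv c c' = alpha \/ dotv c c' = - alpha).

(* The cardinality is a supremum in the extended reals, so no a priori bound
   is built in.  Finite sets suffice: every subset of an equiangular set is
   equiangular, so an infinite one would make the supremum +oo. *)
Definition Nequi (R : realType) (alpha : R) (d : nat) : \bar R :=
  ereal_sup [set (n%:R)%:E | n in
    [set n : nat | exists L : set {vspace 'rV[R]_d},
       equiangular alpha L /\ L #= `I_n]].

(* The suffix %:R makes the literal a nat in decimal representation; without
   it a ring literal of this size is expanded to a unary nat. *)
Definition g4 (R : realType) (a : R) : R := - 7 * a ^+ 14 - 122 * a ^+ 12
  - 342 * a ^+ 10 + 2776 * a ^+ 8 + 7049%:R * a ^+ 6 - 17238%:R * a ^+ 4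
  - 22932%:R * a ^+ 2 - 6048%:R.

Definition g3 (R : realType) (a : R) : R :=
  12 * (4 * a ^+ 16 + 21 * a ^+ 14 - 227 * a ^+ 12 - 46 * a ^+ 10
        + 3338 * a ^+ 8 - 7643%:R * a ^+ 6 + 2693 * a ^+ 4 + 7140%:R * a ^+ 2 + 864).

Definition g2 (R : realType) (a : R) : R :=
  - 9 * a ^+ 2 * (11 * a ^+ 16 - 94 * a ^+ 14 - 25 * a ^+ 12 + 3068 * a ^+ 10
        - 13951%:R * a ^+ 8 + 25882%:R * a ^+ 6 - 15987%:R * a ^+ 4 - 9608%:R * a ^+ 2
        + 14800%:R).

Definition g1 (R : realType) (a : R) : R :=
  54 * a ^+ 2 * (a - 2) ^+ 2 * (a - 1) ^+ 2 * (a + 1) ^+ 2 * (a + 2) ^+ 2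
     * (a ^+ 2 + 1) * (a ^+ 4 - a ^+ 3 - 5 * a ^+ 2 + 3 * a + 10)
     * (a ^+ 4 + a ^+ 3 - 5 * a ^+ 2 - 3 * a + 10).

Definition g0 (R : realType) (a : R) : R :=
  - 81 * a ^+ 2 * (a - 2) ^+ 4 * (a - 1) ^+ 4 * (a + 1) ^+ 4 * (a + 2) ^+ 4.

Definition gpoly (R : realType) (a : R) : {poly R} :=
  g4 a *: 'X^4 + g3 a *: 'X^3 + g2 a *: 'X^2 + g1 a *: 'X + (g0 a)%:P.

(* The maximum real root of gpoly a; by D4_maximum below the supremum
   is attained for every real a >= 3. *)
Definition D4 (R : realType) (a : R) : R := sup [set x | root (gpoly a) x].

(* The filter "a tends to infinity through the odd integers"; named because
   the notation =O_F takes an atomic F. *)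
Definition odd_infty : set_system nat := within [set a : nat | odd a] \oo.

Global Instance odd_infty_filter : Filter odd_infty.
Proof. exact: within_filter. Qed.

Lemma gpolyE (R : realType) (a x : R) : (gpoly a).[x] =
  g4 a * x ^+ 4 + g3 a * x ^+ 3 + g2 a * x ^+ 2 + g1 a * x + g0 a.
Proof. by rewrite /gpoly !hornerE. Qed.

Lemma g4_lt0 (R : realType) (a : R) : 3 <= a -> g4 a < 0.
Proof.
move=> a3; have [t t0 ->] : exists2 t : R, 0 <= t & a = 3 + t.
  by exists (a - 3); [rewrite subr_ge0 | rewrite addrC subrK].
have tk k : 0 <= t ^+ k by exact: exprn_ge0.
rewrite /g4 -subr_gt0 sub0r.
have := (t0, tk 2%N, tk 3%N, tk 4%N, tk 5%N, tk 6%N, tk 7%N, tk 8%N,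
         tk 9%N, tk 10%N, tk 11%N, tk 12%N, tk 13%N, tk 14%N).
move=> [[[[[[[[[[[[[? ?] ?] ?] ?] ?] ?] ?] ?] ?] ?] ?] ?] ?].
lra.
Qed.

Lemma gpoly1_gt0 (R : realType) (a : R) : 3 <= a -> 0 < (gpoly a).[1].
Proof.
move=> a3; have [t t0 ->] : exists2 t : R, 0 <= t & a = 3 + t.
  by exists (a - 3); [rewrite subr_ge0 | rewrite addrC subrK].
have tk k : 0 <= t ^+ k by exact: exprn_ge0.
rewrite gpolyE !expr1n !mulr1 /g4 /g3 /g2 /g1 /g0.
have := (t0, tk 2%N, tk 3%N, tk 4%N, tk 5%N, tk 6%N, tk 7%N, tk 8%N,
         tk 9%N, tk 10%N, tk 11%N, tk 12%N, tk 13%N, tk 14%N, tk 15%N,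
         tk 16%N, tk 17%N, tk 18%N, tk 19%N, tk 20%N).
move=> [[[[[[[[[[[[[[[[[[[? ?] ?] ?] ?] ?] ?] ?] ?] ?] ?] ?] ?] ?] ?] ?] ?] ?] ?] ?].
lra.
Qed.

Lemma gpoly_neq0 (R : realType) (a : R) : 3 <= a -> gpoly a != 0.
Proof.
move=> a3; apply/eqP => g00; have := gpoly1_gt0 a3.
by rewrite g00 horner0 ltxx.
Qed.

Lemma gpoly_root_ex (R : realType) (a : R) :
  3 <= a -> exists x, root (gpoly a) x.
Proof.
move=> a3; have g4N := g4_lt0 a3.
pose S := `|g3 a| + `|g2 a| + `|g1 a| + `|g0 a|.
have S0 : 0 <= S by rewrite /S !addr_ge0.
pose b := 1 + S / - g4 a.
have b1 : 1 <= b by rewrite /b lerDl divr_ge0// oppr_ge0 ltW.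
have bE : g4 a * b + S = g4 a.
  by rewrite /b mulrDr mulr1 invrN mulrN mulrN mulrCA divff ?lt_eqF// mulr1 subrK.
have gb : (gpoly a).[b] <= 0.
  have b0 : 0 <= b by apply: le_trans b1.
  have b2 : 1 <= b ^+ 2 by rewrite expr_ge1.
  have b3 : 0 <= b ^+ 3 by rewrite exprn_ge0.
  have le3 k (c : R) : (k <= 3)%N -> c * b ^+ k <= `|c| * b ^+ 3.
    move=> k3; apply: (@le_trans _ _ (`|c| * b ^+ k)).
      by rewrite ler_wpM2r ?exprn_ge0 ?ler_norm.
    by rewrite ler_wpM2l// ler_weXn2l.
  rewrite gpolyE; apply: (@le_trans _ _ (g4 a * b ^+ 3)); last first.
    by rewrite nmulr_rle0.
  rewrite -[X in _ <= X * _]bE /S.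
  have := le3 3%N (g3 a) isT; have := le3 2%N (g2 a) isT.
  have := le3 1%N (g1 a) isT; have := le3 0%N (g0 a) isT.
  rewrite expr0 expr1 mulr1 [g4 a * b ^+ 4](_ : _ = g4 a * b * b ^+ 3).
    lra.
  by rewrite (exprS b 3) mulrA.
have [|x _ rx] := @poly_ivt R (- gpoly a) 1 b b1; last by exists x; rewrite -rootN.
by rewrite !hornerN oppr_le0 oppr_ge0 gb (ltW (gpoly1_gt0 a3)).
Qed.

Lemma D4_maximum (R : realType) (a : R) : 3 <= a ->
  root (gpoly a) (D4 a) /\ (forall x, root (gpoly a) x -> x <= D4 a).
Proof.
move=> a3; have p0 := gpoly_neq0 a3.
pose s := polyrcf.rootsR (gpoly a).
have sE x : (x \in s) = root (gpoly a) x.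
  by have := polyrcf.roots_on_rootsR p0 x; rewrite in_itv/= => <-.
have [x0 rx0] := gpoly_root_ex a3.
pose m := \big[Num.max/x0]_(x <- s) x.
have rm : root (gpoly a) m.
  rewrite /m big_seq; elim/big_ind: _ => [//|x y rx ry|x].
    by case: (leP x y).
  by rewrite sE.
have mP x : root (gpoly a) x -> x <= m.
  by rewrite -sE => xs; exact: (le_bigmax_seq x0 x xpredT id xs isT).
have -> : D4 a = m.
  apply/eqP; rewrite eq_le; apply/andP; split.
    by apply: ge_sup => [|x]; [exists m|exact: mP].
  by apply: ub_le_sup => //; exists m => x; exact: mP.
by split.
Qed.

(* Main.v *)
Require Import Defs.
From mathcomp Require Import all_boot all_order all_algebra.
From mathcomp Require Import ring lra.
From mathcomp Require Import all_classical all_reals all_analysis.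
Import Order.TTheory GRing.Theory Num.Theory.
Import numFieldNormedType.Exports.

Set Implicit Arguments.
Unset Strict Implicit.
Unset Printing Implicit Defensive.

Local Open Scope classical_set_scope.
Local Open Scope ring_scope.

(** The bound.  Put unit vectors c_i on the lines, with inner products
    +-1/a, and call a triple even when the product of its three inner products
    is positive.  Fix two of the vectors, x and y, and flip signs so that
    <x, y> = 1/a.  The vectors z that form an even triple with x and y can be
    flipped so that <z, x> = <z, y> = 1/a.  Their projections to the orthogonal
    complement of x and y all have the same length, and after normalization
    their mutual inner products are 1/(a+2), when x, z, w form an even triple,
    or -(a+3)/((a-1)(a+2)) otherwise.  The complement has dimension d - 2, so
    the degree 3 Gegenbauer polynomial d h^3 - 3 h of that dimension is a
    positive semidefinite kernel on these projections
    ([cubic_kernel_pair_ge0]), and it stays so when d is replaced by a real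
    D >= d.

    Sum this over all x and y.  In a quadruple of vectors the number of even
    triples is 0, 2 or 4, and this parity allows one to express the number of
    even triples by the numbers F of quadruples of the last kind and H of
    suitably ordered quadruples of the second kind
    ([even3_countE], [quad_sumE]).  The sum takes the form
    F C4 + H C2 >= 0, where C4 and C2 decrease in the number N of lines.  For
    D = crit_dim a = 3 a (a+2)^2 (a-1)^2 / (a^3 + 9 a + 6) both coefficients
    vanish exactly at N = (a^2-1)(a^2-2)/2 ([crit_kernel]).  A larger N
    would make both negative, hence F = H = 0, and there would be no even
    triple at all.  Then the lines carry vectors with pairwise inner product
    -1/a, of which there are at most a + 1 ([card_le_no_even3]), a
    contradiction.  So the bound holds for d <= crit_dim a, and
    D4 a <= crit_dim a because g_a is negative from crit_dim a on
    ([gpoly_lt0_crit_dim]).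

    The expansion.  The polynomial g_a depends on a through a^2 only.  With
    a = sqrt 5 * t one has a^2 = 5 t^2, and the claimed main terms become
    15 t^2 + 12 t - 948/25, so that sqrt 5 disappears.  For t >= 3 the
    polynomial g_a is negative from this point on, and it is nonnegative
    at distance 40/t below it.  Its largest root lies in between
    ([D4_approx_bounds]).

    The sign conditions on polynomials of high degree are all proved in the
    same way: they concern arguments from 3 on, and after a shift by 3 all
    coefficients have the same sign. *)

(** * Positivity of the cubic kernel *)

Section TripleSums.
Variables (R : realType) (J : finType).
Implicit Types F G : J -> J -> J -> R.

Definition sum3 F : R := \sum_i \sum_j \sum_k F i j k.

Lemma eq_sum3 F G : (forall i j k, F i j k = G i j k) -> sum3 F = sum3 G.
Proof. by move=> e; do 3![apply: eq_bigr => ? _]; exact: e. Qed.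

Lemma sum3D F G : sum3 (fun i j k => F i j k + G i j k) = sum3 F + sum3 G.
Proof.
rewrite /sum3 -big_split/=; apply: eq_bigr => i _.
rewrite -big_split/=; apply: eq_bigr => j _; exact: big_split.
Qed.

Lemma sum3Z c F : sum3 (fun i j k => c * F i j k) = c * sum3 F.
Proof.
rewrite /sum3 mulr_sumr; apply: eq_bigr => i _.
by rewrite mulr_sumr; apply: eq_bigr => j _; rewrite mulr_sumr.
Qed.

Lemma sum3_swap12 F : sum3 F = sum3 (fun i j k => F j i k).
Proof. exact: exchange_big. Qed.

Lemma sum3_swap23 F : sum3 F = sum3 (fun i j k => F i k j).
Proof. by apply: eq_bigr => i _; exact: exchange_big. Qed.

Lemma sum3_sum (I : finType) (A : pred I) (F : I -> J -> J -> J -> R) :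
  sum3 (fun i j k => \sum_(z | A z) F z i j k) = \sum_(z | A z) sum3 (F z).
Proof.
rewrite /sum3 [RHS]exchange_big/=; apply: eq_bigr => i _.
rewrite [RHS]exchange_big/=; apply: eq_bigr => j _.
by rewrite [RHS]exchange_big.
Qed.

Lemma sum3_mul (Q : J -> J -> R) (f : J -> R) :
  sum3 (fun i j k => Q i j * f k) = (\sum_i \sum_j Q i j) * \sum_k f k.
Proof.
rewrite /sum3 mulr_suml; apply: eq_bigr => i _.
by rewrite mulr_suml; apply: eq_bigr => j _; rewrite mulr_sumr.
Qed.

Lemma sum3_ge0 F : (forall i j k, 0 <= F i j k) -> 0 <= sum3 F.
Proof. by move=> F0; do 3![apply: sumr_ge0 => ? _]; exact: F0. Qed.

End TripleSums.

(** Let T be the symmetric tensor sum_z u_z (x) u_z (x) u_z over the range of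
    the projection P.  Its traces are multiples of v = sum_z u_z, and
    subtracting a suitable multiple of the symmetrization of P (x) v makes it
    traceless.  The inequality says that the squared norm of the resulting
    tensor is nonnegative. *)
Lemma cubic_kernel_ge (R : realType) (d : nat) (I : finType) (A : pred I) (P : 'M[R]_d)
    (u : I -> 'rV[R]_d) (rho : R) :
    P^T = P -> P *m P = P ->
    (forall z, A z -> u z *m P = u z) ->
    (forall z, A z -> dotv (u z) (u z) = rho) ->
    0 < \tr P + 2 ->
  3 * rho ^+ 2 * (\sum_(z | A z) \sum_(w | A w) dotv (u z) (u w))
    <= (\tr P + 2) * \sum_(z | A z) \sum_(w | A w) dotv (u z) (u w) ^+ 3.
Proof.
move=> PT PP uP urho mgt0; set m := \tr P in mgt0 *.
have Psym i j : P i j = P j i by rewrite -{1}PT mxE.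
have PPE i j : \sum_k P i k * P k j = P i j by rewrite -{3}PP mxE.
have uPE z i : A z -> \sum_j u z ord0 j * P j i = u z ord0 i.
  by move=> Az; rewrite -[in RHS](uP z Az) mxE.
pose v k : R := \sum_(z | A z) u z ord0 k.
pose T i j k : R := \sum_(z | A z) u z ord0 i * u z ord0 j * u z ord0 k.
pose V : R := \sum_k v k ^+ 2.
have vP i : \sum_j v j * P j i = v i.
  rewrite /v; under eq_bigr do rewrite mulr_suml.
  by rewrite exchange_big/=; apply: eq_bigr => z Az; exact: uPE.
have VE : \sum_(z | A z) \sum_(w | A w) dotv (u z) (u w) = V.
  rewrite /V /dotv; under eq_bigr do rewrite exchange_big/=.
  rewrite exchange_big/=; apply: eq_bigr => k _.
  by rewrite expr2 /v big_distrlr.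
have TT : sum3 (fun i j k => T i j k ^+ 2)
    = \sum_(z | A z) \sum_(w | A w) dotv (u z) (u w) ^+ 3.
  transitivity (sum3 (fun i j k => \sum_(z | A z) \sum_(w | A w)
     (u z ord0 i * u w ord0 i * (u z ord0 j * u w ord0 j)) *
     (u z ord0 k * u w ord0 k))).
    apply: eq_sum3 => i j k; rewrite expr2 /T big_distrlr/=.
    by apply: eq_bigr => z _; apply: eq_bigr => w _; ring.
  rewrite sum3_sum; apply: eq_bigr => z _; rewrite sum3_sum.
  apply: eq_bigr => w _; rewrite sum3_mul exprSr; congr (_ * _).
  by rewrite expr2 /dotv big_distrlr.
have TA : sum3 (fun i j k => T i j k * (P i j * v k)) = rho * V.
  transitivity (sum3 (fun i j k => \sum_(z | A z)
     (u z ord0 i * P i j * u z ord0 j) * (u z ord0 k * v k))).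
    apply: eq_sum3 => i j k; rewrite /T mulr_suml.
    by rewrite /T; apply: eq_bigr => z _; ring.
  rewrite sum3_sum -VE mulr_sumr; apply: eq_bigr => z Az.
  rewrite sum3_mul; congr (_ * _).
    rewrite exchange_big/= -(urho z Az); apply: eq_bigr => i _.
    by rewrite -mulr_suml uPE.
  rewrite /dotv exchange_big/=; apply: eq_bigr => k _.
  by rewrite /v mulr_sumr.
have TB : sum3 (fun i j k => T i j k * (P i k * v j)) = rho * V.
  rewrite -TA sum3_swap23; apply: eq_sum3 => i j k; congr (_ * _).
  by rewrite /T; apply: eq_bigr => z _; ring.
have TC : sum3 (fun i j k => T i j k * (P j k * v i)) = rho * V.
  rewrite -TB sum3_swap12; apply: eq_sum3 => i j k; congr (_ * _).
  by rewrite /T; apply: eq_bigr => z _; ring.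
have AA : sum3 (fun i j k => (P i j * v k) ^+ 2) = m * V.
  transitivity (sum3 (fun i j k => (P i j * P j i) * v k ^+ 2)).
    by apply: eq_sum3 => i j k; rewrite (Psym j i); ring.
  rewrite sum3_mul; congr (_ * _); rewrite /m /mxtrace; apply: eq_bigr => i _.
  exact: PPE.
have BB : sum3 (fun i j k => (P i k * v j) ^+ 2) = m * V by rewrite sum3_swap23.
have CC : sum3 (fun i j k => (P j k * v i) ^+ 2) = m * V by rewrite sum3_swap12.
have AB : sum3 (fun i j k => (P i j * v k) * (P i k * v j)) = V.
  rewrite /sum3 exchange_big/= /V; apply: eq_bigr => j _.
  transitivity (v j * \sum_k v k * P k j); last by rewrite vP expr2.
  rewrite exchange_big/= mulr_sumr; apply: eq_bigr => k _.
  rewrite -(PPE k j) !mulr_sumr; apply: eq_bigr => i _.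
  by rewrite (Psym k i); ring.
have AC : sum3 (fun i j k => (P i j * v k) * (P j k * v i)) = V.
  rewrite sum3_swap12 -[RHS]AB; apply: eq_sum3 => i j k.
  by rewrite (Psym j i).
have BC : sum3 (fun i j k => (P i k * v j) * (P j k * v i)) = V.
  rewrite sum3_swap23 -[RHS]AC; apply: eq_sum3 => i j k.
  by rewrite (Psym k j).
(* the multiple of the symmetrization of P (x) v that removes the trace of T *)
pose c := rho / (m + 2).
have : 0 <= sum3 (fun i j k =>
   (T i j k - c * (P i j * v k + P i k * v j + P j k * v i)) ^+ 2).
  by apply: sum3_ge0 => i j k; exact: sqr_ge0.
have -> : sum3 (fun i j k =>
   (T i j k - c * (P i j * v k + P i k * v j + P j k * v i)) ^+ 2) =
   sum3 (fun i j k => T i j k ^+ 2) +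
   - (2 * c) * (rho * V + rho * V + rho * V) +
   c ^+ 2 * (m * V + m * V + m * V + 2 * (V + V + V)).
  rewrite -{1}TA -{1}TB -TC -{1}AA -{1}BB -{1}CC -{1}AB -{1}AC -BC.
  rewrite -!sum3D -!sum3Z -!sum3D -!sum3Z -!sum3D.
  by apply: eq_sum3 => i j k; ring.
rewrite TT VE -(ler_pM2l mgt0) mulr0.
set X := \sum_(z | _) _.
have cE : c * (m + 2) = rho by rewrite /c divfK// gt_eqF.
have -> : (m + 2) * (X + - (2 * c) * (rho * V + rho * V + rho * V) +
   c ^+ 2 * (m * V + m * V + m * V + 2 * (V + V + V))) =
  (m + 2) * X - 6 * (c * (m + 2)) * rho * V + 3 * (c * (m + 2)) ^+ 2 * V by ring.
by rewrite cE; lra.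
Qed.

(** * Projection to the complement of a pair of vectors *)

(** Up to a constant factor, the degree 3 Gegenbauer polynomial of dimension
    [D - 2], made homogeneous so that it applies to vectors of squared length [rho]. *)
Definition cubic_kernel (R : realType) (D rho h : R) : R :=
  D * h ^+ 3 - 3 * rho ^+ 2 * h.

Section Dotv.
Variables (R : realType) (d : nat).
Implicit Types u v w : 'rV[R]_d.

Lemma mulmx_trE u v : u *m v^T = (dotv u v)%:M.
Proof.
rewrite [LHS]mx11_scalar mxE; congr (_%:M).
by apply: eq_bigr => i _; rewrite mxE.
Qed.

Lemma dotvC u v : dotv u v = dotv v u.
Proof. by apply: eq_bigr => i _; rewrite mulrC. Qed.

Lemma dotvDl u v w : dotv (u + v) w = dotv u w + dotv v w.
Proof. by rewrite -big_split/=; apply: eq_bigr => i _; rewrite mxE mulrDl. Qed.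

Lemma dotvZl c u w : dotv (c *: u) w = c * dotv u w.
Proof. by rewrite mulr_sumr; apply: eq_bigr => i _; rewrite mxE mulrA. Qed.

Lemma dotvBl u v w : dotv (u - v) w = dotv u w - dotv v w.
Proof. by rewrite -scaleN1r dotvDl dotvZl mulN1r. Qed.

Lemma dotvDr u v w : dotv w (u + v) = dotv w u + dotv w v.
Proof. by rewrite dotvC dotvDl !(dotvC w). Qed.

Lemma dotvZr c u w : dotv w (c *: u) = c * dotv w u.
Proof. by rewrite dotvC dotvZl dotvC. Qed.

Lemma dotvBr u v w : dotv w (u - v) = dotv w u - dotv w v.
Proof. by rewrite dotvC dotvBl !(dotvC w). Qed.

Lemma dotv_ge0 u : 0 <= dotv u u.
Proof. by apply: sumr_ge0 => i _; rewrite -expr2 sqr_ge0. Qed.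

Lemma dotv_eq0 u : dotv u u = 0 -> u = 0.
Proof.
move=> /eqP; rewrite psumr_eq0 => [/allP u0|i _]; last by rewrite -expr2 sqr_ge0.
apply/rowP => i; rewrite mxE; have := u0 i (mem_index_enum _).
by rewrite /= mulf_eq0 orbb => /eqP.
Qed.

Lemma dotv_suml (I : finType) (A : pred I) (u : I -> 'rV[R]_d) w :
  dotv (\sum_(i | A i) u i) w = \sum_(i | A i) dotv (u i) w.
Proof.
rewrite /dotv exchange_big/=; apply: eq_bigr => k _.
by rewrite summxE mulr_suml.
Qed.

Lemma dotv_sumr (I : finType) (A : pred I) (u : I -> 'rV[R]_d) w :
  dotv w (\sum_(i | A i) u i) = \sum_(i | A i) dotv w (u i).
Proof. by rewrite dotvC dotv_suml; apply: eq_bigr => i _; exact: dotvC. Qed.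

(** For orthogonal [u] and [v], the orthogonal projection to the complement of
    their span. *)
Definition pair_compl_mx u v : 'M[R]_d :=
  1%:M - (dotv u u)^-1 *: (u^T *m u) - (dotv v v)^-1 *: (v^T *m v).

Lemma pair_compl_mxT u v : (pair_compl_mx u v)^T = pair_compl_mx u v.
Proof.
by rewrite /pair_compl_mx !linearB/= !linearZ/= trmx1 !trmx_mul !trmxK.
Qed.

Lemma mul_outer u v (c e : R) :
  (c *: (u^T *m u)) *m (e *: (v^T *m v)) = (c * e * dotv u v) *: (u^T *m v).
Proof.
rewrite -scalemxAl -scalemxAr scalerA -[u^T *m u *m _]mulmxA.
rewrite [u *m (_ *m _)]mulmxA.
by rewrite mulmx_trE mul_scalar_mx -scalemxAr scalerA.
Qed.

Lemma pair_compl_mxK u v : dotv u v = 0 -> dotv u u != 0 -> dotv v v != 0 ->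
  pair_compl_mx u v *m pair_compl_mx u v = pair_compl_mx u v.
Proof.
move=> uv uu vv; rewrite /pair_compl_mx.
rewrite !(mulmxBl, mulmxBr, mul1mx, mulmx1) !mul_outer (dotvC v u) uv.
by rewrite !mulr0 !scale0r !subr0 !mulfVK// subrr subr0 subrr subr0.
Qed.

Lemma mul_pair_compl_mx w u v : dotv w u = 0 -> dotv w v = 0 ->
  w *m pair_compl_mx u v = w.
Proof.
move=> wu wv; rewrite !mulmxBr mulmx1 -!scalemxAr !mulmxA !mulmx_trE wu wv.
by rewrite !mul_scalar_mx !scale0r !scaler0 !subr0.
Qed.

Lemma trace_pair_compl_mx u v : dotv u u != 0 -> dotv v v != 0 ->
  \tr (pair_compl_mx u v) = d%:R - 2.
Proof.
move=> uu vv; rewrite !linearB/= !linearZ/= mxtrace1 !(mxtrace_mulC _^T).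
rewrite !mulmx_trE !mxtrace_scalar/= !mulr1n.
by rewrite !scalerN /GRing.scale/= !mulVf//; lra.
Qed.

(** The vectors [e z] share their component in the span of [x] and [y], of
    squared length [beta], so [dotv (e z) (e w) - beta] is the inner product of
    their projections to the complement.  That space has dimension [d - 2], and
    a larger parameter [D] only adds a multiple of the sum of the cubes, which
    is nonnegative by the case [D = d] because the sum of all inner products is a
    squared length. *)
Lemma cubic_kernel_pair_ge0 (I : finType) (A : pred I) (e : I -> 'rV[R]_d)
    (x y : 'rV[R]_d) (alpha D : R) :
    -1 < alpha < 1 -> (0 < d)%N -> d%:R <= D ->
    dotv x x = 1 -> dotv y y = 1 -> dotv x y = alpha ->
    (forall z, A z -> dotv (e z) (e z) = 1) ->
    (forall z, A z -> dotv (e z) x = alpha) ->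
    (forall z, A z -> dotv (e z) y = alpha) ->
  forall beta, beta = 2 * alpha ^+ 2 / (1 + alpha) ->
  0 <= \sum_(z | A z) \sum_(w | A w)
    cubic_kernel D (1 - beta) (dotv (e z) (e w) - beta).
Proof.
move=> /andP[am1 a1] d0 dD xx yy xy ee ex ey beta betaE.
have ap : 1 + alpha != 0 by rewrite gt_eqF//; lra.
pose u z := e z + - (alpha / (1 + alpha)) *: (x + y).
have uE (z w : I) : A z -> A w -> dotv (u z) (u w) = dotv (e z) (e w) - beta.
  move=> Az Aw; rewrite /u !(dotvZl, dotvZr, dotvDl, dotvDr).
  rewrite (dotvC x (e w)) (dotvC y (e w)) (dotvC y x) xx yy xy !ex// !ey//.
  by rewrite betaE; field.
(* an orthogonal basis of the span of x and y *)
pose s := x + y; pose t := x - y.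
have ss : dotv s s = 2 * (1 + alpha).
  by rewrite /s !(dotvDl, dotvDr) (dotvC y x) xx yy xy; ring.
have tt : dotv t t = 2 * (1 - alpha).
  by rewrite /t !(dotvBl, dotvBr) (dotvC y x) xx yy xy; ring.
have st : dotv s t = 0.
  by rewrite /s /t !(dotvDl, dotvBr) (dotvC y x) xx yy; ring.
have ss0 : dotv s s != 0 by rewrite ss gt_eqF//; lra.
have tt0 : dotv t t != 0 by rewrite tt gt_eqF//; lra.
have us z : A z -> dotv (u z) s = 0.
  move=> Az; rewrite /u dotvDl dotvZl -/s ss /s dotvDr ex// ey//; by field.
have ut z : A z -> dotv (u z) t = 0.
  move=> Az; rewrite /u dotvDl dotvZl -/s st /t dotvBr ex// ey//; ring.
have d0' : 0 < d%:R :> R by rewrite ltr0n.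
have := @cubic_kernel_ge R d I A (pair_compl_mx s t) u (1 - beta)
  (pair_compl_mxT s t) (pair_compl_mxK st ss0 tt0)
  (fun z Az => mul_pair_compl_mx (us z Az) (ut z Az)).
rewrite trace_pair_compl_mx// subrK => ker0.
have urho z : A z -> dotv (u z) (u z) = 1 - beta by move=> Az; rewrite uE// ee.
have {ker0} ker := ker0 urho d0'.
have S1 : 0 <= \sum_(z | A z) \sum_(w | A w) dotv (u z) (u w).
  have -> : \sum_(z | A z) \sum_(w | A w) dotv (u z) (u w) =
      dotv (\sum_(z | A z) u z) (\sum_(z | A z) u z).
    by rewrite dotv_suml; apply: eq_bigr => z _; rewrite dotv_sumr.
  exact: dotv_ge0.
have -> : \sum_(z | A z) \sum_(w | A w)
    cubic_kernel D (1 - beta) (dotv (e z) (e w) - beta) =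
   D * (\sum_(z | A z) \sum_(w | A w) dotv (u z) (u w) ^+ 3)
    - 3 * (1 - beta) ^+ 2 * (\sum_(z | A z) \sum_(w | A w) dotv (u z) (u w)).
  rewrite !mulr_sumr -sumrB; apply: eq_bigr => z Az.
  by rewrite !mulr_sumr -sumrB; apply: eq_bigr => w Aw; rewrite uE.
move: ker S1; set Y := \sum_(z | A z) _; set X := \sum_(z | A z) _ => ker Y0.
have b2 : 0 <= (1 - beta) ^+ 2 by exact: sqr_ge0.
have Z0 : 0 <= (1 - beta) ^+ 2 * Y by exact: mulr_ge0.
have X0 : 0 <= X by rewrite -(pmulr_rge0 _ d0'); lra.
have : d%:R * X <= D * X by rewrite ler_wpM2r.
lra.
Qed.
End Dotv.

(** * Counting triples and quadruples by parity *)

Section TwoGraph.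
Variables (R : realType) (J : finType) (s : J -> J -> bool).
Hypothesis sC : forall i j, s i j = s j i.

(** With [s i j] the sign bit of an inner product, these are the triples with a
    positive product.  They do not change when a vector is replaced by its
    opposite, so they depend on the lines only. *)
Definition even3 i j k := [&& i != j, i != k, j != k & ~~ (s i j (+) s i k (+) s j k)].

Lemma even3_swap12 i j k : even3 i j k = even3 j i k.
Proof.
rewrite /even3 (sC j i) (eq_sym j i); case: (i != j) => //=.
by rewrite andbCA -!addbA [s i k (+) _]addbC.
Qed.

Lemma even3_swap23 i j k : even3 i j k = even3 i k j.
Proof.
rewrite /even3 (sC k j) (eq_sym k j) andbCA.
by rewrite -!addbA [s i j (+) _]addbCA.
Qed.

(** In four points the number of even triples is even, since each pair lies in
    two triples.  Three even triples through [i] thus force all four to be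
    even; if [i j k] and [i j l] are even and [i k l] is not, then neither is
    [j k l]. *)
Definition quad4 i j k l := [&& even3 i j k, even3 i j l & even3 i k l].
Definition quad2 i j k l :=
  [&& even3 i j k, even3 i j l, k != l & ~~ even3 i k l].

(** Among the other three triples of [i j k l] the number of even ones is odd:
    either all three, or exactly one, which then shares the pair [i j], [i k]
    or [j k] with the triple [i j k]. *)
Lemma even3_split i j k l : even3 i j k ->
  [&& l != i, l != j & l != k]%:R =
    (quad4 i j k l)%:R + ((quad2 i j k l)%:R + (quad2 i k j l)%:R
       + (quad2 k j i l)%:R) :> R.
Proof.
move=> ijk; have ikj : even3 i k j by rewrite even3_swap23.
have kji : even3 k j i by rewrite even3_swap12 even3_swap23 even3_swap12.
rewrite /quad4 /quad2 ijk ikj kji/=.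
move: ijk; rewrite /even3 => /and4P[ij ik jk].
rewrite ij ik (eq_sym k j) (eq_sym k i) ?jk ?ik/= !(eq_sym l) (sC k j) (sC k i).
case: (i != l); case: (j != l); case: (k != l) => //=; rewrite ?andbF ?addr0//.
by case: (s i j); case: (s i k); case: (s j k) => //= _;
  case: (s i l); case: (s j l); case: (s k l) => //=; rewrite ?(addr0, add0r).
Qed.

Definition even3_count : R := sum3 (fun i j k => (even3 i j k)%:R).
Definition quad4_count : R := sum3 (fun i j k => \sum_l (quad4 i j k l)%:R).
Definition quad2_count : R := sum3 (fun i j k => \sum_l (quad2 i j k l)%:R).

Lemma quad4_count_ge0 : 0 <= quad4_count.
Proof. by apply: sum3_ge0 => i j k; apply: sumr_ge0 => l _; exact: ler0n. Qed.

Lemma quad2_count_ge0 : 0 <= quad2_count.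
Proof. by apply: sum3_ge0 => i j k; apply: sumr_ge0 => l _; exact: ler0n. Qed.

(** Count the pairs of an even triple and a fourth point.  The three terms
    [quad2] of [even3_split] differ by a permutation of the points, so they
    have the same sum. *)
Lemma even3_countE :
  (#|J|%:R - 3) * even3_count = quad4_count + 3 * quad2_count.
Proof.
have -> : 3 * quad2_count = quad2_count
   + sum3 (fun i j k => \sum_l (quad2 i k j l)%:R)
   + sum3 (fun i j k => \sum_l (quad2 k j i l)%:R).
  rewrite -(sum3_swap23 (fun i j k => \sum_l (quad2 i j k l)%:R)).
  rewrite (_ : sum3 (fun i j k => \sum_l (quad2 k j i l)%:R) = quad2_count).
    by rewrite /quad2_count; ring.
  by rewrite sum3_swap12 sum3_swap23 sum3_swap12.
rewrite addrA addrA /even3_count /quad4_count /quad2_count -!sum3D -sum3Z.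
apply: eq_sum3 => i j k; rewrite -!big_split/=.
have [ijk|nijk] := boolP (even3 i j k); last first.
  rewrite mulr0 big1// => l _; rewrite /quad4 /quad2.
  have nikj : even3 i k j = false by rewrite even3_swap23 (negbTE nijk).
  have nkji : even3 k j i = false.
    by rewrite even3_swap12 even3_swap23 even3_swap12 (negbTE nijk).
  by rewrite (negbTE nijk) nikj nkji !addr0.
rewrite mulr1; move: (ijk) => /and4P[ij ik jk _].
transitivity (\sum_l [&& l != i, l != j & l != k]%:R : R); last first.
  by apply: eq_bigr => l _; rewrite even3_split// -!addrA.
have one (m : J) : \sum_l (l == m)%:R = 1 :> R.
  by rewrite (bigD1 m)//= eqxx big1 ?addr0// => l /negbTE ->.
have cardE : #|J|%:R = \sum_(l : J) 1 :> R by rewrite sumr_const.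
transitivity (\sum_l (1 - (l == i)%:R - (l == j)%:R - (l == k)%:R) : R).
  by rewrite !sumrB !one -cardE; ring.
apply: eq_bigr => l _.
case: (eqVneq l i) => [->|_] /=; first by rewrite (negbTE ij) (negbTE ik) !subr0 subrr.
case: (eqVneq l j) => [->|_] /=; first by rewrite (negbTE jk) !subr0 subrr.
by case: (l == k); rewrite /= !subr0 ?subrr.
Qed.

Lemma quad_sumE (k1 kp km : R) :
  \sum_i \sum_j \sum_(k | even3 i j k) \sum_(l | even3 i j l)
     (if k == l then k1 else if even3 i k l then kp else km)
  = k1 * even3_count + kp * quad4_count + km * quad2_count.
Proof.
rewrite /even3_count /quad4_count /quad2_count -!sum3Z -!sum3D.
apply: eq_bigr => i _; apply: eq_bigr => j _.
rewrite big_mkcond/=; apply: eq_bigr => k _.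
rewrite !mulr_sumr -addrA -big_split/=.
have [ijk|nijk] := boolP (even3 i j k); last first.
  rewrite mulr0 add0r big1// => l _.
  by rewrite /quad4 /quad2 (negbTE nijk)/= !mulr0 addr0.
rewrite mulr1 big_mkcond/= (bigD1 k)//= ijk eqxx [in RHS](bigD1 k)//=.
have kk : even3 i k k = false by rewrite /even3 eqxx !andbF.
rewrite /quad4 /quad2 kk eqxx !andbF !mulr0 !add0r; congr (_ + _).
apply: eq_bigr => l lk; rewrite ijk (eq_sym k l) (negbTE lk)/=.
by case: (even3 i j l) => /=; case: (even3 i k l) => /=; ring.
Qed.

End TwoGraph.

(** * Bounding the number of vectors with inner products [a^-1] up to sign *)

(** The dimension for which the two coefficients of [crit_kernel] vanish at the
    same number of lines; the first equation there determines it. *)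
Definition crit_dim (R : realType) (a : R) : R :=
  3 * a * (a + 2) ^+ 2 * (a - 1) ^+ 2 / (a ^+ 3 + 9 * a + 6).

(** Here [rho] is the squared length of the projected vectors,
    [(a - 1) / (a * (a + 1))] and [- (a + 3) / (a * (a + 1))] are their mutual
    inner products, and
    [M + 3 = (a ^+ 2 - 1) * (a ^+ 2 - 2) / 2] is the claimed bound. *)
Lemma crit_kernel (R : realType) (a : R) : 3 <= a ->
  let rho := (a + 2) * (a - 1) / (a * (a + 1)) in
  let K := cubic_kernel (crit_dim a) rho in
  let M := (a ^+ 2 - 4) * (a ^+ 2 + 1) / 2 in
  [/\ 0 < M, 0 < K rho, K rho + M * K ((a - 1) / (a * (a + 1))) = 0
    & 3 * K rho + M * K (- (a + 3) / (a * (a + 1))) = 0].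
Proof.
move=> a3 rho K M.
have a0 : 0 < a by lra.
have a1 : 0 < a + 1 by lra.
have a21 : 0 < (a + 2) * (a - 1) by apply: mulr_gt0; lra.
have q0 : 0 < a ^+ 3 + 9 * a + 6.
  by apply: addr_gt0 => //; rewrite addr_gt0 ?exprn_gt0// mulr_gt0.
have an0 : a != 0 by rewrite gt_eqF.
have a1n0 : a + 1 != 0 by rewrite gt_eqF.
have qn0 : a ^+ 3 + 9 * a + 6 != 0 by rewrite gt_eqF.
have rho0 : 0 < rho by rewrite /rho divr_gt0// mulr_gt0.
split.
- have a9 : 0 <= (a - 3) * (a - 3) by apply: mulr_ge0; lra.
  by rewrite /M divr_gt0// mulr_gt0//; lra.
- rewrite /K /cubic_kernel (_ : _ - _ = rho ^+ 3 * (crit_dim a - 3)); last by ring.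
  rewrite mulr_gt0 ?exprn_gt0// subr_gt0 /crit_dim ltr_pdivlMr//.
  have [t t0 ->] : exists2 t, 0 <= t & a = 3 + t by exists (a - 3); lra.
  have tk k : 0 <= t ^+ k by exact: exprn_ge0.
  by have := (t0, tk 2%N, tk 3%N, tk 4%N, tk 5%N) => -[[[[? ?] ?] ?] ?]; lra.
- by rewrite /K /cubic_kernel /M /rho /crit_dim; field; rewrite an0 a1n0 qn0.
- by rewrite /K /cubic_kernel /M /rho /crit_dim; field; rewrite an0 a1n0 qn0.
Qed.

Section System.
Variables (R : realType) (d : nat) (J : finType) (c : J -> 'rV[R]_d).
Variables (s : J -> J -> bool) (a : R).
Hypothesis sC : forall i j, s i j = s j i.
Hypothesis a3 : 3 <= a.
Hypothesis c1 : forall i, dotv (c i) (c i) = 1.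
Hypothesis cE : forall i j, i != j -> dotv (c i) (c j) = (-1) ^+ s i j / a.

Let a0 : 0 < a. Proof. exact: lt_le_trans a3. Qed.

(** After flipping signs all inner products are [- a^-1], and the squared length
    of the sum of the vectors is nonnegative. *)
Lemma card_le_no_even3 : (forall i j k, ~~ even3 s i j k) -> #|J|%:R <= a + 1.
Proof.
move=> no; have a0' := a0.
have [x _|J0] := pickP (@predT J); last first.
  by rewrite (eq_card0 J0); lra.
pose e z : 'rV[R]_d := if z == x then c x else - (-1) ^+ s x z *: c z.
have ez z : dotv (e z) (e z) = 1.
  rewrite /e; case: eqP => // _.
  by rewrite dotvZl dotvZr c1 mulr1 mulrNN -expr2 sqrr_sign.
have en z w : z != w -> dotv (e z) (e w) = - a^-1.
  move=> zw; rewrite /e; case: (eqVneq z x) => [zx|zx].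
    rewrite -zx eq_sym (negbTE zw) dotvZr cE// mulNr mulrA -signr_addb addbb.
    by rewrite mul1r.
  case: (eqVneq w x) => [wx|wx].
    rewrite wx in zw *; rewrite dotvZl cE// mulNr mulrA sC -signr_addb addbb.
    by rewrite mul1r.
  rewrite dotvZl dotvZr cE// !mulNr mulrN opprK !mulrA -!signr_addb.
  have := no x z w; rewrite /even3 (eq_sym x z) zx (eq_sym x w) wx zw/= negbK.
  by move=> ->; rewrite mulN1r.
have : 0 <= dotv (\sum_z e z) (\sum_z e z) by exact: dotv_ge0.
have -> : dotv (\sum_z e z) (\sum_z e z) = #|J|%:R * (1 - (#|J|%:R - 1) / a).
  rewrite dotv_suml.
  rewrite mulr_natl -sumr_const.
  apply: eq_bigr => z _; rewrite dotv_sumr (bigD1 z)//= ez; congr (_ + _).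
  rewrite (eq_bigr (fun=> - a^-1)); last by move=> w wz; rewrite en// eq_sym.
  rewrite sumr_const mulNrn -[a^-1 *+ _]mulr_natl; congr (- (_ * _)).
  have -> : #|[pred i | i != z]| = #|J|.-1 by rewrite cardC1.
  by rewrite -subn1 natrB//; apply/card_gt0P; exists z.
rewrite pmulr_rge0; last by rewrite ltr0n; apply/card_gt0P; exists x.
by rewrite subr_ge0 ler_pdivrMr// mul1r; lra.
Qed.

Lemma card_equiangular_system : (0 < d)%N -> d%:R <= crit_dim a ->
  #|J|%:R <= 2^-1 * (a ^+ 2 - 1) * (a ^+ 2 - 2).
Proof.
move=> d0 dD; have [a0' a3'] := (a0, a3); set N : R := #|J|%:R; set N0 := 2^-1 * _ * _.
have [//|N0N] := leP N N0.
have := crit_kernel a3; cbv zeta; set rho := _ / (a * (a + 1)).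
set K := cubic_kernel _ rho; set M := _ / 2.
set hp := _ / (a * (a + 1)); set hm := _ / (a * (a + 1)).
move=> [M0 K0 Kp Km].
have a1 : a + 1 != 0 by rewrite gt_eqF//; lra.
have an0 : a != 0 by rewrite gt_eqF.
have MN : M < N - 3 by move: N0N; rewrite /N0 /M; lra.
(* the kernel inequality, summed over all pairs x, y *)
have pos : 0 <= K rho * even3_count R s + K hp * quad4_count R s
    + K hm * quad2_count R s.
  rewrite -quad_sumE; apply: sumr_ge0 => x _; apply: sumr_ge0 => y _.
  have [->|xy] := eqVneq x y.
    by rewrite big1// => z; rewrite /even3 eqxx.
  have a1' : -1 < a^-1 < 1.
    have := invr_gt0 a; rewrite a0 => ?.
    by rewrite invf_lt1//; lra.
  pose e z : 'rV[R]_d := (-1) ^+ s x z *: c z.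
  have sgn1 b : (-1 : R) ^+ b * (-1) ^+ b = 1 by rewrite -expr2 sqrr_sign.
  have ee z : dotv (e z) (e z) = 1 by rewrite /e dotvZl dotvZr c1 mulr1.
  pose beta := 2 * a^-1 ^+ 2 / (1 + a^-1).
  have rhoE : rho = 1 - beta.
    by rewrite /rho /beta; field; rewrite an0 a1.
  have := @cubic_kernel_pair_ge0 R d J (even3 s x y) e (c x)
    ((-1) ^+ s x y *: c y) a^-1 (crit_dim a) a1' d0 dD (c1 x).
  rewrite dotvZl !dotvZr c1 mulr1 sgn1 cE// mulrA sgn1 mul1r.
  move=> /(_ erefl erefl (fun z _ => ee z)).
  move=> /(_ _ _ beta erefl); rewrite -rhoE.
  move=> ker; apply: le_trans (ker _ _) _ => {ker}.
  - move=> z /and4P[_ xz _ _].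
    by rewrite /e dotvZl cE 1?eq_sym// sC mulrA sgn1 mul1r.
  - move=> z /and4P[_ xz yz par].
    rewrite /e dotvZl dotvZr cE 1?eq_sym// (sC z y) !mulrA -!signr_addb.
    rewrite (_ : _ (+) _ = false) ?mul1r//.
    by move: par; case: (s x y); case: (s x z); case: (s y z).
  have hpE : hp = a^-1 - beta.
    by rewrite /hp /beta; field; rewrite an0 a1.
  have hmE : hm = - a^-1 - beta.
    by rewrite /hm /beta; field; rewrite an0 a1.
  apply: ler_sum => z xyz; apply: ler_sum => w xyw.
  have [<-|zw] := eqVneq z w; first by rewrite ee -rhoE.
  have [xz xw] : x != z /\ x != w by case/and4P: xyz xyw => _ ? _ _ /and4P[].
  have -> : dotv (e z) (e w) = (-1) ^+ (s x z (+) s x w (+) s z w) / a.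
    by rewrite /e dotvZl dotvZr cE// !mulrA -!signr_addb.
  rewrite /even3 xz xw zw/=; case: (s x z (+) s x w (+) s z w) => /=.
    by rewrite expr1 mulN1r -hmE.
  by rewrite expr0 mul1r -hpE.
have N3 : 0 < N - 3 by exact: lt_trans MN.
clearbody K.
have Kp0 : K hp < 0 by rewrite -(pmulr_rlt0 _ M0); lra.
have Km0 : K hm < 0 by rewrite -(pmulr_rlt0 _ M0); lra.
(* the coefficients of quad4_count and quad2_count in N - 3 times the kernel
   inequality, once the even triples are expressed by quadruples *)
have C4 : K rho + (N - 3) * K hp < 0.
  by have : (N - 3) * K hp < M * K hp; [rewrite ltr_nM2r | lra].
have C2 : 3 * K rho + (N - 3) * K hm < 0.
  by have : (N - 3) * K hm < M * K hm; [rewrite ltr_nM2r | lra].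
have T3 := even3_countE R sC; rewrite -/N in T3.
have F0 := quad4_count_ge0 R s; have H0 := quad2_count_ge0 R s.
have T0 : even3_count R s = 0.
  move: pos; rewrite -(pmulr_rge0 _ N3) => pos.
  have {}pos : 0 <= (K rho + (N - 3) * K hp) * quad4_count R s
       + (3 * K rho + (N - 3) * K hm) * quad2_count R s.
    apply: le_trans pos _; rewrite le_eqVlt; apply/orP; left; apply/eqP.
    have : K rho * ((N - 3) * even3_count R s) =
       K rho * (quad4_count R s + 3 * quad2_count R s) by rewrite T3.
    by move=> ?; lra.
  have P4 := mulr_ge0_le0 F0 (ltW C4).
  have P2 := mulr_ge0_le0 H0 (ltW C2).
  have : (K rho + (N - 3) * K hp) * quad4_count R s = 0 by lra.
  have : (3 * K rho + (N - 3) * K hm) * quad2_count R s = 0 by lra.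
  move=> /eqP; rewrite mulf_eq0 (lt_eqF C2)/= => /eqP H00.
  move=> /eqP; rewrite mulf_eq0 (lt_eqF C4)/= => /eqP F00.
  apply/eqP; move/eqP: T3; rewrite H00 F00 mulr0 addr0 mulf_eq0.
  by rewrite (gt_eqF N3).
have no i j k : ~~ even3 s i j k.
  apply/negP => ijk; move: T0; apply/eqP; rewrite gt_eqF// /even3_count /sum3.
  rewrite (bigD1 i)//= ltr_pwDl//; last first.
    by do 3![apply: sumr_ge0 => ? _]; exact: ler0n.
  rewrite (bigD1 j)//= ltr_pwDl//; last first.
    by do 2![apply: sumr_ge0 => ? _]; exact: ler0n.
  rewrite (bigD1 k)//= ltr_pwDl//; first by rewrite ijk.
  by apply: sumr_ge0 => ? _; exact: ler0n.
have := card_le_no_even3 no; rewrite -/N => Na.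
have MA : a < M - 1.
  rewrite /M; have a9 : 0 <= (a - 3) * (a - 3) by apply: mulr_ge0; lra.
  have a5 : 5 * (a ^+ 2 + 1) <= (a ^+ 2 - 4) * (a ^+ 2 + 1).
    by rewrite ler_wpM2r//; lra.
  by lra.
by lra.
Qed.
End System.

(** * From equiangular lines to vectors *)

Lemma unit_vector_of_line (R : realType) (d : nat) (l : {vspace 'rV[R]_d}) :
  \dim l = 1%N -> exists2 c, c \in l & dotv c c = 1.
Proof.
move=> dl; pose v := vpick l.
have v0 : v != 0 by rewrite vpick0 -dimv_eq0 dl.
have vv : 0 < dotv v v.
  rewrite lt_neqAle dotv_ge0 andbT eq_sym; apply/eqP => /dotv_eq0 /eqP.
  by rewrite (negbTE v0).
exists ((Num.sqrt (dotv v v))^-1 *: v); first by rewrite memvZ ?memv_pick.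
rewrite dotvZl dotvZr mulrA -expr2 exprVn sqr_sqrtr ?ltW// mulVf//.
by rewrite gt_eqF.
Qed.

Lemma equiangular_system (R : realType) (d n : nat) (a : R)
    (L : set {vspace 'rV[R]_d}) :
  0 < a -> equiangular a^-1 L -> (L #= `I_n)%card ->
  exists (c : 'I_n -> 'rV[R]_d) (s : 'I_n -> 'I_n -> bool),
    [/\ forall i j, s i j = s j i, forall i, dotv (c i) (c i) = 1
      & forall i j, i != j -> dotv (c i) (c j) = (-1) ^+ s i j / a].
Proof.
move=> a0 [L1 La] /card_set_bijP[f [fL finj fsurj]].
have /choice[l lP] : forall i : 'I_n, exists l, L l /\ f l = i.
  by move=> i; have [l Ll fl] := fsurj i (ltn_ord i); exists l.
have /choice[c cP] : forall i : 'I_n, exists c, c \in l i /\ dotv c c = 1.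
  by move=> i; have [c] := unit_vector_of_line (L1 _ (lP i).1); exists c.
(* the sign bit; inner products are nonzero off the diagonal *)
exists c, (fun i j => dotv (c i) (c j) < 0); split => [i j|i|i j ij].
- by rewrite dotvC.
- exact: (cP i).2.
have lij : l i <> l j.
  move=> lij; move/eqP: ij; apply; apply: val_inj.
  by rewrite /= -(lP i).2 -(lP j).2 lij.
have [->|->] := La _ _ (lP i).1 (lP j).1 lij _ _ (cP i).1 (cP j).1 (cP i).2 (cP j).2.
- by rewrite ltNge invr_ge0 ltW// mul1r.
- by rewrite oppr_lt0 invr_gt0 a0 mulN1r.
Qed.

Lemma Nequi_le (R : realType) (d : nat) (a : R) :
  3 <= a -> (0 < d)%N -> d%:R <= crit_dim a ->
  (Nequi a^-1 d <= (2^-1 * (a ^+ 2 - 1) * (a ^+ 2 - 2))%:E)%E.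
Proof.
move=> a3 d0 dD; apply: ge_ereal_sup => _ [n [L [eqL Ln]] <-]; rewrite lee_fin.
have [c [s [sC c1 cE]]] := equiangular_system (lt_le_trans (ltr0Sn _ 2) a3) eqL Ln.
by have := card_equiangular_system sC a3 c1 cE d0 dD; rewrite card_ord.
Qed.

(** * Comparing D4 with the critical dimension *)

(** The hypotheses say that the Taylor coefficients at [p / q] are negative,
    with denominators cleared. *)
Lemma quartic_lt0 (R : realFieldType) (c4 c3 c2 c1 c0 p q x : R) :
    0 < q -> p <= q * x ->
    c4 < 0 ->
    4 * c4 * p + c3 * q < 0 ->
    6 * c4 * p ^+ 2 + 3 * c3 * p * q + c2 * q ^+ 2 < 0 ->
    4 * c4 * p ^+ 3 + 3 * c3 * p ^+ 2 * q + 2 * c2 * p * q ^+ 2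
      + c1 * q ^+ 3 < 0 ->
    c4 * p ^+ 4 + c3 * p ^+ 3 * q + c2 * p ^+ 2 * q ^+ 2 + c1 * p * q ^+ 3
      + c0 * q ^+ 4 < 0 ->
  c4 * x ^+ 4 + c3 * x ^+ 3 + c2 * x ^+ 2 + c1 * x + c0 < 0.
Proof.
move=> q0 pqx s4 s3 s2 s1 s0; have q4 : 0 < q ^+ 4 by exact: exprn_gt0.
have [e e0 eE] : exists2 e, 0 <= e & q * x = p + e.
  by exists (q * x - p); [rewrite subr_ge0 | ring].
have ek k : 0 <= e ^+ k by exact: exprn_ge0.
rewrite -(pmulr_rlt0 _ q4).
have -> : q ^+ 4 * (c4 * x ^+ 4 + c3 * x ^+ 3 + c2 * x ^+ 2 + c1 * x + c0) =
   c4 * (q * x) ^+ 4 + c3 * (q * x) ^+ 3 * q + c2 * (q * x) ^+ 2 * q ^+ 2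
   + c1 * (q * x) * q ^+ 3 + c0 * q ^+ 4 by ring.
rewrite eE.
have := mulr_le0_ge0 (ltW s4) (ek 4%N); have := mulr_le0_ge0 (ltW s3) (ek 3%N).
have := mulr_le0_ge0 (ltW s2) (ek 2%N); have := mulr_le0_ge0 (ltW s1) e0.
lra.
Qed.

(** Puts the nonnegativity of the powers of [t] in the context, so that [lra],
    which treats distinct monomials as independent unknowns, proves the sign of
    a polynomial in [t] from the signs of its coefficients. *)
Ltac nonneg_powers t t0 :=
  have tk k : 0 <= t ^+ k by [exact: exprn_ge0];
  have := (t0, tk 2%N, tk 3%N, tk 4%N, tk 5%N, tk 6%N, tk 7%N, tk 8%N,
    tk 9%N, tk 10%N, tk 11%N, tk 12%N, tk 13%N, tk 14%N, tk 15%N, tk 16%N,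
    tk 17%N, tk 18%N, tk 19%N, tk 20%N, tk 21%N, tk 22%N, tk 23%N, tk 24%N,
    tk 25%N, tk 26%N, tk 27%N, tk 28%N, tk 29%N, tk 30%N, tk 31%N, tk 32%N);
  move=> [[[[[[[[[[[[[[[[[[[[[[[[[[[[[[[? ?] ?] ?] ?] ?] ?] ?] ?] ?] ?] ?] ?]
    ?] ?] ?] ?] ?] ?] ?] ?] ?] ?] ?] ?] ?] ?] ?] ?] ?] ?] ?].

Lemma gpoly_lt0_crit_dim (R : realType) (a x : R) :
  3 <= a -> crit_dim a <= x -> (gpoly a).[x] < 0.
Proof.
move=> a3; have q0 : 0 < a ^+ 3 + 9 * a + 6.
  by have := exprn_ge0 3 (le_trans (ler0n _ 3) a3); lra.
rewrite /crit_dim ler_pdivrMr// [x * _]mulrC => px; rewrite gpolyE.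
have g4N := g4_lt0 a3.
have [t t0 aE] : exists2 t : R, 0 <= t & a = 3 + t.
  by exists (a - 3); [rewrite subr_ge0 | ring].
apply: (quartic_lt0 q0 px g4N); rewrite aE {px q0 g4N a3 aE}
  /g4 /g3 /g2 /g1 /g0; nonneg_powers t t0.
- lra.
- lra.
- lra.
- lra.
Qed.

Lemma D4_le_crit_dim (R : realType) (a : R) : 3 <= a -> D4 a <= crit_dim a.
Proof.
move=> a3; rewrite leNgt; apply/negP => /ltW /(gpoly_lt0_crit_dim a3).
by have [/rootP -> _] := D4_maximum a3; rewrite ltxx.
Qed.

(** * The asymptotic expansion of D4 *)

Section Asymptotics.
Variable R : realType.
Implicit Types a b t x : R.

(** The coefficients of [gpoly a] as polynomials in [b = a ^+ 2]. *)
Definition g4sq b : R := - 7 * b ^+ 7 - 122 * b ^+ 6 - 342 * b ^+ 5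
  + 2776 * b ^+ 4 + 7049%:R * b ^+ 3 - 17238%:R * b ^+ 2 - 22932%:R * b
  - 6048%:R.

Definition g3sq b : R :=
  12 * (4 * b ^+ 8 + 21 * b ^+ 7 - 227 * b ^+ 6 - 46 * b ^+ 5 + 3338 * b ^+ 4
        - 7643%:R * b ^+ 3 + 2693 * b ^+ 2 + 7140%:R * b + 864).

Definition g2sq b : R :=
  - 9 * b * (11 * b ^+ 8 - 94 * b ^+ 7 - 25 * b ^+ 6 + 3068 * b ^+ 5
        - 13951%:R * b ^+ 4 + 25882%:R * b ^+ 3 - 15987%:R * b ^+ 2
        - 9608%:R * b + 14800%:R).

Definition g1sq b : R :=
  54 * b * (b - 4) ^+ 2 * (b - 1) ^+ 2 * (b + 1)
     * ((b ^+ 2 - 5 * b + 10) ^+ 2 - b * (b - 3) ^+ 2).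

Definition g0sq b : R := - 81 * b * (b - 4) ^+ 4 * (b - 1) ^+ 4.

Lemma gpoly_sqE a x : (gpoly a).[x] =
  g4sq (a ^+ 2) * x ^+ 4 + g3sq (a ^+ 2) * x ^+ 3 + g2sq (a ^+ 2) * x ^+ 2
    + g1sq (a ^+ 2) * x + g0sq (a ^+ 2).
Proof.
rewrite gpolyE; congr (_ * _ + _ * _ + _ * _ + _ * _ + _).
- by rewrite /g4 /g4sq; ring.
- by rewrite /g3 /g3sq; ring.
- by rewrite /g2 /g2sq; ring.
- by rewrite /g1 /g1sq; ring.
- by rewrite /g0 /g0sq; ring.
Qed.

(** The main terms of the expansion of [D4 a] at [a = Num.sqrt 5 * t]. *)
Definition D4_approx t : R := 15 * t ^+ 2 + 12 * t - 948 / 25.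

Lemma gpoly_lt0_approx a t x : 3 <= t -> a ^+ 2 = 5 * t ^+ 2 ->
  D4_approx t <= x -> (gpoly a).[x] < 0.
Proof.
move=> t3 at2 tx; rewrite gpoly_sqE at2.
have {tx} : D4_approx t <= 1 * x by rewrite mul1r.
have [e e0 ->] : exists2 e, 0 <= e & t = 3 + e.
  by exists (t - 3); [rewrite subr_ge0 | ring].
move=> /(quartic_lt0 ltr01); apply;
  rewrite /D4_approx /g4sq /g3sq /g2sq /g1sq /g0sq; nonneg_powers e e0.
- lra.
- lra.
- lra.
- lra.
- lra.
Qed.

(** The next term of the expansion of [D4 a] is about [- 31 / t], so the point
    [40 / t] below the main terms lies to the left of the largest root. *)
Lemma gpoly_ge0_approx a t : 3 <= t -> a ^+ 2 = 5 * t ^+ 2 ->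
  0 <= (gpoly a).[D4_approx t - 40 / t].
Proof.
move=> t3 at2; rewrite gpoly_sqE at2.
have t0 : 0 < t by lra.
have t4 : 0 < t ^+ 4 by exact: exprn_gt0.
rewrite -(pmulr_rge0 _ t4); set x := _ - _.
have -> c4 c3 c2 c1 c0 :
    t ^+ 4 * (c4 * x ^+ 4 + c3 * x ^+ 3 + c2 * x ^+ 2 + c1 * x + c0) =
    c4 * (t * x) ^+ 4 + c3 * (t * x) ^+ 3 * t + c2 * (t * x) ^+ 2 * t ^+ 2
     + c1 * (t * x) * t ^+ 3 + c0 * t ^+ 4 by ring.
have -> : t * x = t * D4_approx t - 40.
  by rewrite /x; field; rewrite gt_eqF.
have [e e0 ->] : exists2 e, 0 <= e & t = 3 + e.
  by exists (t - 3); [rewrite subr_ge0 | ring].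
rewrite /D4_approx /g4sq /g3sq /g2sq /g1sq /g0sq; nonneg_powers e e0.
lra.
Qed.

(** Above [D4_approx t] the polynomial has no root, and the intermediate value
    theorem gives one just below. *)
Lemma D4_approx_bounds a t : 3 <= a -> 3 <= t -> a ^+ 2 = 5 * t ^+ 2 ->
  D4_approx t - 40 / t <= D4 a <= D4_approx t.
Proof.
move=> a3 t3 at2; have [/rootP r0 rmax] := D4_maximum a3.
apply/andP; split; last first.
  rewrite leNgt; apply/negP => /ltW /(gpoly_lt0_approx t3 at2).
  by rewrite r0 ltxx.
have le : D4_approx t - 40 / t <= D4_approx t.
  by rewrite gerBl divr_ge0//; lra.
have [|y /andP[ly _] ry] := @poly_ivt R (- gpoly a) _ _ le.
  rewrite !hornerN oppr_le0 oppr_ge0 gpoly_ge0_approx//=.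
  by rewrite ltW// (gpoly_lt0_approx t3 at2).
by apply: le_trans ly (rmax _ _); rewrite -rootN.
Qed.

Lemma D4_asymptotic a : 7 <= a ->
  `|D4 a - (3 * a ^+ 2 + 12 / Num.sqrt 5 * a - 948 / 25)| <= 120 * a^-1.
Proof.
move=> a7; set r := Num.sqrt 5.
have r0 : 0 < r by rewrite sqrtr_gt0.
have rr : r ^+ 2 = 5 by rewrite sqr_sqrtr.
have r3 : r <= 3.
  by rewrite -(@ler_pXn2r _ 2) ?nnegrE ?ltW// rr; lra.
have a0 : 0 < a by lra.
pose t := a / r.
have aE : a = r * t by rewrite /t mulrC divfK// gt_eqF.
have at2 : a ^+ 2 = 5 * t ^+ 2 by rewrite aE exprMn rr.
have t3 : 3 <= t.
  rewrite -(@ler_pXn2r _ 2) ?nnegrE ?divr_ge0 ?ltW//.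
  have : 7 ^+ 2 <= a ^+ 2 by rewrite ler_pXn2r// ?nnegrE ltW.
  by rewrite at2; lra.
have t0 : 0 < t by lra.
have a3 : 3 <= a by lra.
have := D4_approx_bounds a3 t3 at2.
have -> : 3 * a ^+ 2 + 12 / r * a - 948 / 25 = D4_approx t.
  by rewrite at2 /D4_approx /t; ring.
have tb : 40 / t <= 120 * a^-1.
  have -> : a^-1 = r^-1 * t^-1 by rewrite -invfM -aE.
  rewrite mulrA ler_pM2r ?invr_gt0//.
  by rewrite ler_pdivlMr//; lra.
move=> /andP[lo up]; rewrite ler_norml; apply/andP; split; first by lra.
by have : 0 <= 120 * a^-1 by [rewrite mulr_ge0// invr_ge0 ltW]; lra.
Qed.

End Asymptotics.

Theorem theorem1p3 (R : realType) :
  (forall a d : nat, odd a -> (3 <= a)%N -> (0 < d)%N ->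
     d%:R <= D4 (a%:R : R) ->
     (Nequi (a%:R^-1 : R) d
        <= (2^-1 * (a%:R ^+ 2 - 1) * (a%:R ^+ 2 - 2))%:E)%E) /\
  (fun a : nat => D4 (a%:R : R)
       - (3 * a%:R ^+ 2 + 12 / Num.sqrt 5 * a%:R - 948 / 25) : R^o)
    =O_odd_infty (fun a : nat => a%:R^-1 : R^o).
Proof.
split=> [a d _ a3 d0 dD|].
  have a3R : 3 <= a%:R :> R by rewrite ler_nat.
  by apply: Nequi_le => //; apply: le_trans dD (D4_le_crit_dim a3R).
apply/eqO_exP; exists 120 => //.
exists 7%N => // a /= a7 _.
have a7R : 7 <= a%:R :> R by rewrite ler_nat.
apply: le_trans (D4_asymptotic a7R) _.
by rewrite ler_pM2l// ler_norm.
Qed.
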